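(* Let $F$ be a positive integer and let $X$ be an $\mathrm{Arf}(F)$-set. Then $\mathrm{Arf}(F)[X]$ is the smallest element (with respect to inclusion) of $\mathrm{Arf}(F)$ containing $X$.
   Context: $\mathbb{N}$ denotes the set of nonnegative integers. A numerical semigroup is a subset $S\subseteq\mathbb{N}$ that contains $0$, is closed under addition, and has finite complement in $\mathbb{N}$. The Frobenius number $\mathrm{F}(S)$ is the greatest integer not in $S$. An A-semigroup (Arf numerical semigroup) is a numerical semigroup $S$ such that $x+y-z\in S$ for all $x,y,z\in S$ with $x\ge y\ge z$. $\mathrm{Arf}(F)$ is the set of A-semigroups with Frobenius number $F$; its minimum with respect to inclusion is $\Delta(F)=\{0\}\cup\{n\in\mathbb{N}\mid n\ge F+1\}$. A set $X$ is an $\mathrm{Arf}(F)$-set if $X\cap\Delta(F)=\emptyset$ and there is $S\in\mathrm{Arf}(F)$ such that $X\subseteq S$. For an $\mathrm{Arf}(F)$-set $X$, $\mathrm{Arf}(F)[X]$ denotes the intersection of all elements of $\mathrm{Arf}(F)$ containing $X$. *)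

(* Defs.v *)
From mathcomp Require Import all_boot all_order all_algebra.
From mathcomp Require Import boolp classical_sets functions cardinality.

Set Implicit Arguments.
Unset Strict Implicit.
Unset Printing Implicit Defensive.

Local Open Scope classical_set_scope.

Definition numerical_semigroup (S : set nat) : Prop :=
  [/\ S 0, (forall x y, S x -> S y -> S (x + y)) & finite_set (~` S)].

(* [F] ranges over all integers because the semigroup [setT] has Frobenius
   number [-1]: the complement of [S] is taken in the integers. *)
Definition is_frobenius_number (S : set nat) (F : int) : Prop :=
  let gaps : set int := ~` (Posz @` S) in
  gaps F /\ ubound gaps F.

(* The subtraction on [nat] is never truncated here, since [z <= y]. *)
Definition A_semigroup (S : set nat) : Prop :=
  numerical_semigroup S /\
  forall x y z, S x -> S y -> S z -> z <= y -> y <= x -> S (x + y - z).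

Definition Arf (F : nat) : set (set nat) :=
  [set S | A_semigroup S /\ is_frobenius_number S (Posz F)].

Definition Delta (F : nat) : set nat := [set 0] `|` [set n | F + 1 <= n].

Definition Arf_set (F : nat) (X : set nat) : Prop :=
  X `&` Delta F = set0 /\ exists S, Arf F S /\ X `<=` S.

Definition Arf_containing (F : nat) (X : set nat) : set (set nat) :=
  [set S | Arf F S /\ X `<=` S].

Definition Arf_closure (F : nat) (X : set nat) : set nat :=
  \bigcap_(S in Arf_containing F X) S.

Definition is_smallest (C : set (set nat)) (M : set nat) : Prop :=
  C M /\ forall T, C T -> M `<=` T.

(* Main.v *)
Require Import Defs.
From mathcomp Require Import all_boot all_order all_algebra.
From mathcomp Require Import boolp classical_sets functions cardinality.

(** Every defining condition of Arf(F) passes to an arbitrary nonempty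
    intersection.  The closure conditions (containing 0, sums, and x + y - z) do
    so member by member.  The two conditions that could fail for infinitely many
    sets, finiteness of the complement and the value of the Frobenius number,
    survive because F is common to all members: a set has Frobenius number F
    exactly when it misses F and contains every natural number above F
    ([is_frobenius_numberP]).  The first half is inherited from any one member,
    which is where nonemptiness enters, and the second holds for the
    intersection and confines its complement to [0, F].  Hence
    [Arf_bigcap]; applied to the members of Arf(F) that contain X, it shows that
    their intersection is itself such a member, and it lies in all the others. *)

Local Open Scope classical_set_scope.

(** Negative integers are gaps of every set of naturals but lie below F, so the
    condition on the complement in the integers reduces to one on naturals. *)
Lemma is_frobenius_numberP (S : set nat) (F : nat) :
  is_frobenius_number S (Posz F) <-> ~ S F /\ forall n, F < n -> S n.
Proof.
split=> [[gapF ubF]|[nSF SgtF]].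
- split=> [SF|n ltFn]; first by apply: gapF; exists F.
  apply: contrapT => nSn.
  have : (Posz n <= Posz F)%O by apply: ubF => -[m Sm [eq_mn]]; rewrite -eq_mn in nSn.
  by rewrite lez_nat leqNgt ltFn.
- split=> [[m Sm [eq_mF]]|[n|n] gapn //]; first by rewrite eq_mF in Sm.
  rewrite lez_nat leqNgt; apply/negP => ltFn.
  by apply: gapn; exists n => //; apply: SgtF.
Qed.

Lemma Arf_bigcap (F : nat) (C : set (set nat)) :
  C !=set0 -> C `<=` Arf F -> Arf F (\bigcap_(S in C) S).
Proof.
move=> [S0 CS0] CArf.
have capgtF n : F < n -> (\bigcap_(S in C) S) n.
  by move=> ltFn S /CArf[_ /is_frobenius_numberP[_]]; apply.
split; last first.
  apply/is_frobenius_numberP; split=> // /(_ _ CS0).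
  by have [_ /is_frobenius_numberP[]] := CArf _ CS0.
split; first split.
- by move=> S /CArf[[[]]].
- move=> x y capx capy S CS; have [[[_ SD _] _] _] := CArf _ CS.
  by apply: SD; [apply: capx | apply: capy].
- apply: (@sub_finite_set _ _ `I_F.+1); last exact: finite_II.
  by move=> n ncapn /=; rewrite ltnS leqNgt; apply/negP => /capgtF.
- move=> x y z capx capy capz lezy leyx S CS; have [[_ SArf] _] := CArf _ CS.
  by apply: SArf => //; [apply: capx | apply: capy | apply: capz].
Qed.

Theorem proposition6p1 (F : nat) (X : set nat) (hF : 0 < F)
  (hX : Arf_set F X) :
  is_smallest (Arf_containing F X) (Arf_closure F X).
Proof.
have [_ [S0 ArfS0]] := hX.
split; last by move=> T CT n; apply.
split; last by move=> x Xx S [_]; apply.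
by apply: Arf_bigcap; [exists S0 | move=> S []].
Qed.
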